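(* Let $a,b\in\mathbb C\setminus\{0\}$ and let $H:\mathbb C^3\to\mathbb C^3$ be the polynomial automorphism $H(x,y,z)=(xy+az,\;x^2+by,\;x)$. For $\epsilon>0$ sufficiently small and $R$ sufficiently large (depending on $\epsilon$), let $$V^-=\left\{(x,y,z)\in\mathbb C^3:\ |xy|>\max\left\{R,\ 2|az|,\ |x|^{3/2},\ \tfrac1\epsilon|y|^{3/2}\right\}\right\},\qquad U^+=\bigcup_{n=0}^\infty H^{-n}(V^-),\qquad K^+=\mathbb C^3\setminus U^+.$$ Let $\overline{K^+}$ denote the closure of $K^+$ in $\mathbb P^3$, and let $I^+_\infty=\{t=x=0\}\cup\{t=y=0\}\subset\mathbb P^3$. Then $$\overline{K^+}=K^+\cup I^+_\infty .$$
   Context: $\mathbb P^3$ is complex projective space with homogeneous coordinates $[x:y:z:t]$; $\mathbb C^3$ is identified with $\{t\neq0\}$ via $(x,y,z)\mapsto[x:y:z:1]$, so $\{t=0\}$ is the hyperplane at infinity. The parameters are fixed with $\epsilon>0$ small and $R$ large, so that in particular $H(V^-)\subset V^-$. The set $I^+_\infty$ (called the extended indeterminacy set) is a union of two lines in the hyperplane at infinity. *)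

(* Defs.v *)
From HB Require Import structures.
From mathcomp Require Import all_boot all_order all_algebra.
From mathcomp Require Import generic_quotient complex.
From mathcomp Require Import all_classical all_reals.
From mathcomp Require Import topology normedtype exp.

Set Implicit Arguments.
Unset Strict Implicit.
Unset Printing Implicit Defensive.

Import Order.TTheory GRing.Theory Num.Theory.
Import numFieldNormedType.Exports.

Local Open Scope classical_set_scope.
Local Open Scope ring_scope.
Local Open Scope complex_scope.
Local Open Scope quotient_scope.

Section ProjectiveSpace.
Variable R : realType.

(* The library's norm topology on a numFieldType is not found on complex R. *)
HB.instance Definition _ := PseudoPointedMetric.copy R[i] R[i]^o.
HB.instance Definition _ := NormedModule.copy R[i] R[i]^o.

(* set_type carries the topology induced by that of 'rV[R[i]]_4. *)
Definition hvec : Type := set_type [set v : 'rV[R[i]]_4 | v != 0].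

HB.instance Definition _ := Topological.copy hvec
  (set_type [set v : 'rV[R[i]]_4 | v != 0]).

Definition proportional (u v : hvec) : bool :=
  `[< exists2 c : R[i], c != 0 & val v = c *: val u >].

Lemma proportional_refl : reflexive proportional.
Proof. by move=> u; apply/asboolP; exists 1; rewrite ?oner_neq0 ?scale1r. Qed.

Lemma proportional_sym : symmetric proportional.
Proof.
have sym u v : proportional u v -> proportional v u.
  move=> /asboolP[c c0 vE]; apply/asboolP; exists c^-1; first by rewrite invr_eq0.
  by rewrite vE scalerA mulVf// scale1r.
by move=> u v; apply/idP/idP; exact: sym.
Qed.

Lemma proportional_trans : transitive proportional.
Proof.
move=> v u w /asboolP[c c0 vE] /asboolP[d d0 wE]; apply/asboolP.
by exists (d * c); rewrite ?mulf_neq0// wE vE scalerA.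
Qed.

Canonical proportional_equiv :=
  EquivRel proportional proportional_refl proportional_sym proportional_trans.

Definition P3 : Type := quotient_topology {eq_quot proportional}.

HB.instance Definition _ := Topological.copy P3
  (quotient_topology {eq_quot proportional}).

Definition hclass (v : hvec) : P3 := \pi_{eq_quot proportional} v.

(* Positions of the homogeneous coordinates x, y and t in [x : y : z : t]. *)
Definition ix : 'I_4 := @Ordinal 4 0 isT.
Definition iy : 'I_4 := @Ordinal 4 1 isT.
Definition it : 'I_4 := @Ordinal 4 3 isT.

Definition coordinate (v : hvec) (i : 'I_4) : R[i] := (val v : 'rV[R[i]]_4) 0 i.

Definition C3 : Type := R[i] * R[i] * R[i].

Definition affine_row (p : C3) : 'rV[R[i]]_4 :=
  let: (x, y, z) := p in \row_(i < 4) [:: x; y; z; 1]`_i.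

Lemma affine_row_neq0 (p : C3) : affine_row p \in [set v : 'rV[R[i]]_4 | v != 0].
Proof.
rewrite inE /=; case: p => [[x y] z]; apply/eqP => /rowP /(_ it).
by rewrite !mxE /=; apply/eqP; rewrite oner_neq0.
Qed.

(* (x, y, z) |-> [x : y : z : 1] *)
Definition affine (p : C3) : P3 := hclass (exist _ (affine_row p) (affine_row_neq0 p)).

Definition Iplus_infty : set P3 :=
  hclass @` [set v | coordinate v it = 0 /\ coordinate v ix = 0] `|`
  hclass @` [set v | coordinate v it = 0 /\ coordinate v iy = 0].

End ProjectiveSpace.

Section Dynamics.
Variable R : realType.
Local Notation C3 := (C3 R).

Definition cabs (z : R[i]) : R := ComplexField.Normc.normc z.

Definition Hmap (a b : R[i]) (p : C3) : C3 :=
  let: (x, y, z) := p in (x * y + a * z, x ^+ 2 + b * y, x).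

(* r is the large parameter written R in the mathematics. *)
Definition Vminus (a : R[i]) (eps r : R) : set C3 :=
  [set p | let: (x, y, z) := p in
    Num.max r (Num.max (2 * cabs (a * z))
      (Num.max (cabs x `^ (3 / 2)) (eps^-1 * cabs y `^ (3 / 2)))) < cabs (x * y)].

Definition Uplus (a b : R[i]) (eps r : R) : set C3 :=
  \bigcup_(n in [set: nat]) (iter n (Hmap a b) @^-1` Vminus a eps r).

Definition Kplus (a b : R[i]) (eps r : R) : set C3 := ~` Uplus a b eps r.

End Dynamics.

(* Main.v *)
Require Import Defs.
From mathcomp Require Import all_boot all_order all_algebra.
From mathcomp Require Import complex.
From mathcomp Require Import all_classical all_reals.
From mathcomp Require Import topology normedtype exp.
From mathcomp Require Import ring lra.

(* A limit point of [K+] at infinity lies on [xy = 0], because the homogenized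
   inequalities defining [V-] cut out an open set of [C^4] which meets [t = 0]
   exactly in [xy <> 0].

   Conversely [phi (x, y, z) = x^2 y] satisfies [phi o H = phi^2] on [V-], up to
   a factor in [[1/8, 4]], and [H] maps [V-] into itself.  Near a point of
   [I+_oo] there are complex lines, along which only [x] or only [y] varies,
   containing a disk whose center and boundary circle lie in [V-], with [|phi|]
   at least 32 times larger on the circle than at the center.  This ratio
   persists for [phi o H^n], which is a polynomial along the line, so by the
   minimum modulus principle it vanishes somewhere in the disk: a point there
   has its first [n] iterates outside [V-].  A cluster point of these points as
   [n] grows belongs to [K+]. *)

Set Implicit Arguments.
Unset Strict Implicit.
Unset Printing Implicit Defensive.

Import Order.TTheory GRing.Theory Num.Theory.
Import numFieldNormedType.Exports.

Local Open Scope classical_set_scope.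
Local Open Scope ring_scope.

(** * Modulus on [R[i]] and the minimum modulus principle for polynomials *)

Section ComplexModulus.
Variable R : realType.
Implicit Types z w : R[i].

Lemma normr_cabs z : `|z| = (cabs z)%:C%C.
Proof. by rewrite normc_def; case: z. Qed.

Lemma cabs_ge0 z : 0 <= cabs z.
Proof. by case: z => u v; exact: sqrtr_ge0. Qed.

Lemma cabs0 : cabs (0 : R[i]) = 0.
Proof. exact: ComplexField.Normc.normc0. Qed.

Lemma cabs1 : cabs (1 : R[i]) = 1.
Proof. exact: ComplexField.Normc.normc1. Qed.

Lemma cabsM z w : cabs (z * w) = cabs z * cabs w.
Proof. exact: ComplexField.Normc.normcM. Qed.

Lemma cabsV z : cabs z^-1 = (cabs z)^-1.
Proof. exact: ComplexField.Normc.normcV. Qed.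

Lemma cabsN z : cabs (- z) = cabs z.
Proof. exact: normcN. Qed.

Lemma cabsX z n : cabs (z ^+ n) = cabs z ^+ n.
Proof. by elim: n => [|n IH]; rewrite ?expr0 ?cabs1// !exprS cabsM IH. Qed.

Lemma cabsD z w : cabs (z + w) <= cabs z + cabs w.
Proof. exact: le_normcD. Qed.

Lemma cabsD_ge z w : cabs z - cabs w <= cabs (z + w).
Proof. by have := cabsD (z + w) (- w); rewrite addrK cabsN; lra. Qed.

Lemma cabs_eq0 z : (cabs z == 0) = (z == 0).
Proof.
apply/eqP/eqP => [|->]; last exact: cabs0.
exact: ComplexField.Normc.eq0_normc.
Qed.

Lemma cabs_gt0 z : (0 < cabs z) = (z != 0).
Proof. by rewrite lt0r cabs_ge0 andbT cabs_eq0. Qed.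

Lemma cabs_real (u : R) : 0 <= u -> cabs (u%:C%C : R[i]) = u.
Proof. by move=> u0; rewrite /cabs /= expr0n addr0 sqrtr_sqr ger0_norm. Qed.

Lemma cabs_prod (I : Type) (s : seq I) (F : I -> R[i]) :
  cabs (\prod_(i <- s) F i) = \prod_(i <- s) cabs (F i).
Proof. by apply: (big_morph _ cabsM cabs1). Qed.

Lemma le_normr_Re z : `|complex.Re z| <= cabs z.
Proof. by rewrite -lecR -normr_cabs normc_ge_Re. Qed.

Lemma le_normr_Im z : `|complex.Im z| <= cabs z.
Proof.
case: z => u v; rewrite /cabs /= -sqrtr_sqr ler_sqrt ?lerDr ?sqr_ge0//.
by rewrite addr_ge0// sqr_ge0.
Qed.

(* Minimum modulus principle.  If all the roots of [f] had modulus larger than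
   [rho], then, multiplying over the roots of ['X^N - rho^N],
   [\prod_w |f w / f 0| = \prod_(f r = 0) |1 - (rho / r)^N| <= 2^(deg f)],
   whereas the left-hand side is at least [2^N]. *)
Lemma root_of_min_modulus (f : {poly R[i]}) (rho : R) : 0 < rho ->
  (forall w, cabs w = rho -> 2 * cabs f.[0] <= cabs f.[w]) ->
  exists2 w, root f w & cabs w <= rho.
Proof.
move=> rho0 fcirc; apply: contrapT => nroot.
have [rs fE] := closed_field_poly_normal f.
set c := lead_coef f in fE.
have f00 : f.[0] != 0.
  by apply/eqP => /rootP rf; apply: nroot; exists 0; rewrite ?cabs0 ?ltW.
have c0 : c != 0.
  by apply: contra_neq f00 => c0; rewrite fE c0 scale0r horner0.
have rlarge r : r \in rs -> rho <= cabs r.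
  move=> rrs; rewrite leNgt; apply/negP => lr; apply: nroot; exists r; last exact: ltW.
  by rewrite fE rootZ// root_prod_XsubC.
(* One more than the number of roots of [f], so that the final inequality [2 ^+ N <= 2 ^+ size rs]
   is absurd. *)
pose N := (size rs).+1.
have [ws gE] := closed_field_poly_normal ('X^N - (rho%:C%C ^+ N)%:P : {poly R[i]}).
have lg : lead_coef ('X^N - (rho%:C%C ^+ N)%:P : {poly R[i]}) = 1.
  exact: lead_coefXnsubC.
rewrite lg scale1r in gE.
have wsN : size ws = N.
  have := congr1 (fun p : {poly R[i]} => size p) gE.
  by rewrite /= size_XnsubC// size_prod_XsubC => -[].
have hg z : z ^+ N - rho%:C%C ^+ N = \prod_(w <- ws) (z - w).
  have := congr1 (fun p : {poly R[i]} => p.[z]) gE; rewrite /= !hornerE horner_prod => ->.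
  by apply: eq_bigr => w _; rewrite !hornerE.
have wmod w : w \in ws -> cabs w = rho.
  move=> wws; have : w ^+ N - rho%:C%C ^+ N = 0.
    by rewrite hg; apply/eqP; rewrite prodf_seq_eq0; apply/hasP; exists w => //=; rewrite subrr.
  move/eqP; rewrite subr_eq0 => /eqP /(congr1 (@cabs R)).
  rewrite !cabsX cabs_real ?ltW// => /eqP; rewrite eqrXn2 ?cabs_ge0 ?ltW//.
  by move/eqP.
have hf z : cabs f.[z] = cabs c * \prod_(r <- rs) cabs (z - r).
  rewrite fE hornerZ horner_prod cabsM cabs_prod; congr (_ * _).
  by apply: eq_bigr => w _; rewrite !hornerE.
have prodcst (s : seq R[i]) (u : R) : \prod_(w <- s) u = u ^+ size s.
  by rewrite big_const_seq count_predT iter_mulr_1.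
have low : (2 * cabs f.[0]) ^+ N <= \prod_(w <- ws) cabs f.[w].
  rewrite -wsN -prodcst big_seq [leRHS]big_seq; apply: ler_prod => w wws.
  by rewrite mulr_ge0 ?cabs_ge0//= fcirc// wmod.
have high : \prod_(w <- ws) cabs f.[w] <= 2 ^+ size rs * cabs f.[0] ^+ N.
  under eq_bigr do rewrite hf.
  (* Once the products are exchanged, a root [r] of [f] contributes |r^N - rho^N| <= 2 |r|^N,
     because rho <= |r|; the factors |r|^N rebuild |f(0)|^N. *)
  rewrite big_split /= prodcst wsN exchange_big /= hf exprMn mulrCA.
  rewrite ler_wpM2l ?exprn_ge0 ?cabs_ge0// -prodrXl -prodcst -big_split /=.
  rewrite big_seq [leRHS]big_seq; apply: ler_prod => r rrs.
  rewrite prodr_ge0/= => [|*]; last exact: cabs_ge0.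
  under eq_bigr do rewrite -cabsN opprB.
  rewrite -cabs_prod -hg sub0r [in leRHS]cabsN mulr_natl mulr2n.
  rewrite (le_trans (cabsD _ _))// [cabs (- _)]cabsN !cabsX lerD2l lerXn2r ?nnegrE ?cabs_ge0//.
  by rewrite cabs_real; [exact: rlarge | exact: ltW].
have := le_trans low high; rewrite exprMn ler_pM2r; last first.
  by rewrite exprn_gt0// cabs_gt0.
by rewrite ler_eXn2l ?ltr1n// ltnn.
Qed.
End ComplexModulus.

(** * Forward invariance of V^- and growth of [phi] *)

(** Here X, Y, Z are the moduli of the coordinates of a point of V^-, and x1, y1, X those of its
    image. On V^- the monomials xy and x^2 dominate: AZ < XY/2 and BY <= X^2/2, so x1 and y1 agree
    with XY and X^2 up to factors in [1/2, 3/2]. Hence x1^2 y1 is (X^2 Y)^2 up to a factor between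
    1/8 and 27/8. *)
Lemma escape_estimates (R : realFieldType) (e s A B X Y Z x1 y1 : R) :
  0 < e -> 0 <= s -> 8 * e ^+ 2 <= 1 -> 2 * B * e ^+ 2 <= 1 -> 8 * A <= s ->
  24 ^+ 3 <= s * e ^+ 6 -> 0 <= A -> 0 <= B -> 0 <= X -> 0 <= Y -> 0 <= x1 -> 0 <= y1 ->
  x1 <= X * Y + A * Z -> X * Y - A * Z <= x1 ->
  y1 <= X ^+ 2 + B * Y -> X ^+ 2 - B * Y <= y1 ->
  s < X * Y -> 2 * A * Z < X * Y -> X < Y ^+ 2 -> Y < e ^+ 2 * X ^+ 2 ->
  [/\ [/\ s < x1 * y1, 2 * A * X < x1 * y1, x1 < y1 ^+ 2 & y1 < e ^+ 2 * x1 ^+ 2],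
      (X ^+ 2 * Y) ^+ 2 <= 8 * (x1 ^+ 2 * y1) &
      x1 ^+ 2 * y1 <= 4 * (X ^+ 2 * Y) ^+ 2].
Proof.
move=> e0 s0 e1 eb sa se A0 B0 X0 Y0 x10 y10 x1u x1l y1u y1l h1 h2 h3 h4.
have XY : 0 < X * Y by apply: le_lt_trans h1.
have Xp : 0 < X.
  by rewrite lt_neqAle X0 andbT eq_sym; apply: contraTneq XY => ->; rewrite mul0r ltxx.
have Yp : 0 < Y.
  by rewrite lt_neqAle Y0 andbT eq_sym; apply: contraTneq XY => ->; rewrite mulr0 ltxx.
have YX : 8 * Y < X ^+ 2 by move: h4 e1 (sqr_ge0 X); clear; nra.
(* From 8Y < X^2 and X < Y^2 one gets 64 X < 64 Y^2 < X^4, so X^3 > 64. *)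
have X4 : 4 < X.
  have XX : 64 * X < X ^+ 4 by move: YX Yp h3; clear; nra.
  rewrite ltNge; apply/negP => X4.
  have : X ^+ 3 <= 64 by rewrite (_ : 64 = 4 ^+ 3) ?lerXn2r ?nnegrE//; lra.
  move: XX Xp; clear; nra.
have Y2 : 2 < Y by move: X4 h3 Yp; clear; nra.
have e20 : 0 < e ^+ 2 by exact: exprn_gt0.
(* Compare cubes: Y^3 > XY > s, and s e^6 >= 24^3. *)
have eY : 24 < e ^+ 2 * Y.
  rewrite -(@ltr_pXn2r _ 3) ?nnegrE ?ler0n ?pmulr_rge0//.
  rewrite (le_lt_trans se)// exprMn -exprM mulrC ltr_pM2l ?exprn_gt0//.
  by rewrite (lt_trans h1)// exprSr ltr_pM2r.
have hx1 : X * Y <= 2 * x1 by move: x1l h2; clear; lra.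
have hx2 : 2 * x1 <= 3 * (X * Y) by move: x1u h2; clear; lra.
have BY : 2 * (B * Y) <= X ^+ 2.
  have : B * Y <= B * (e ^+ 2 * X ^+ 2) by rewrite ler_wpM2l// ltW.
  move: eb (sqr_ge0 X); clear; nra.
have hy1 : X ^+ 2 <= 2 * y1 by move: y1l BY; clear; lra.
have hy2 : 2 * y1 <= 3 * X ^+ 2 by move: y1u BY; clear; lra.
have X20 : 0 <= X ^+ 2 by exact: sqr_ge0.
have XY0 : 0 <= X * Y by exact: ltW.
have p1 : X * Y * X ^+ 2 <= 4 * (x1 * y1).
  by rewrite (_ : 4 * _ = (2 * x1) * (2 * y1)); [exact: ler_pM|ring].
have X16 : 16 < X ^+ 2 by move: X4; clear; nra.
have px : (X * Y) ^+ 2 <= 4 * x1 ^+ 2.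
  have -> : 4 * x1 ^+ 2 = (2 * x1) ^+ 2 by ring.
  by rewrite lerXn2r ?nnegrE ?mulr_ge0.
have px' : 4 * x1 ^+ 2 <= 9 * (X * Y) ^+ 2.
  have -> : 4 * x1 ^+ 2 = (2 * x1) ^+ 2 by ring.
  have -> : 9 * (X * Y) ^+ 2 = (3 * (X * Y)) ^+ 2 by ring.
  by rewrite lerXn2r ?nnegrE ?mulr_ge0.
have py : X ^+ 2 * X ^+ 2 <= 4 * y1 ^+ 2.
  have -> : 4 * y1 ^+ 2 = (2 * y1) * (2 * y1) by ring.
  exact: ler_pM.
have X2p : 0 < X ^+ 2 by exact: exprn_gt0.
have X3p : 0 < X ^+ 3 by exact: exprn_gt0.
split; first split.
- have := ler_wpM2l XY0 (ltW X16).
  move: p1 h1 XY; clear; lra.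
- have : 8 * A * X <= X * Y * X by rewrite ler_wpM2r// (le_trans sa)// ltW.
  have : X * Y * X < X * Y * X ^+ 2 by rewrite ltr_pM2l// expr2 ltr_pMr//; move: X4; clear; lra.
  move: p1; clear; lra.
- have := ler_wpM2l X0 (ltW YX).
  have := ler_wpM2l (ltW X3p) (ltW X4).
  move: hx2 py X3p; clear; lra.
- have : 24 * Y < e ^+ 2 * Y * Y by rewrite ltr_pM2r.
  have : 0 < (e ^+ 2 * Y ^+ 2 - 48) * X ^+ 2.
    by rewrite mulr_gt0//; move: eY Y2; clear; nra.
  have : e ^+ 2 * (X * Y) ^+ 2 <= e ^+ 2 * (4 * x1 ^+ 2) by rewrite ler_wpM2l// sqr_ge0.
  move: hy2 X2p; clear; lra.
- have : (X * Y) ^+ 2 * X ^+ 2 <= (4 * x1 ^+ 2) * (2 * y1) by rewrite ler_pM// sqr_ge0.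
  clear; lra.
- have : (4 * x1 ^+ 2) * (2 * y1) <= 9 * (X * Y) ^+ 2 * (3 * X ^+ 2).
    by rewrite ler_pM// ?mulr_ge0 ?sqr_ge0.
  have : 0 <= (X ^+ 2 * Y) ^+ 2 by exact: sqr_ge0.
  clear; lra.
Qed.

Section Escape.
Variables (R : realType) (a b : R[i]) (eps r : R).
Hypotheses (eps0 : 0 < eps) (r0 : 0 <= r).
Local Notation H := (Hmap a b).
Local Notation V := (Vminus a eps r).

Lemma powR_ltr32 (u w : R) : 0 <= u -> 0 <= w -> (u `^ (3 / 2) < w) = (u ^+ 3 < w ^+ 2).
Proof.
move=> u0 w0; rewrite -[RHS](_ : (u `^ (3 / 2)) ^+ 2 < w ^+ 2 = _).
  by rewrite ltr_pXn2r// nnegrE powR_ge0.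
congr (_ < _); rewrite -powR_mulrn ?powR_ge0// -powRrM.
by rewrite (_ : 3 / 2 * 2%:R = 3%:R) ?powR_mulrn//; lra.
Qed.

(** Squaring removes the exponents 3/2, and a power of |x| or |y| cancels, both being positive since
    |xy| > r >= 0. The resulting polynomial inequalities can be homogenized. *)
Lemma VminusE (x y z : R[i]) : V (x, y, z) =
  [/\ r < cabs x * cabs y, 2 * cabs a * cabs z < cabs x * cabs y,
      cabs x < cabs y ^+ 2 & cabs y < eps ^+ 2 * cabs x ^+ 2] :> Prop.
Proof.
apply/propext; rewrite /Vminus /= !gt_max !cabsM ltr_pdivrMl//.
rewrite !powR_ltr32 ?mulr_ge0 ?cabs_ge0 ?ltW//.
rewrite !exprMn mulrA.
have [x0 y0] := (cabs_ge0 x, cabs_ge0 y).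
have pos (u v : R) : r < u * v -> 0 <= u -> 0 <= v -> 0 < u /\ 0 < v.
  move=> ruv u0 v0; have : 0 < u * v by exact: le_lt_trans ruv.
  by move=> uv; split; rewrite lt_neqAle ?u0 ?v0 andbT eq_sym; apply: contraTneq uv => ->;
    rewrite ?mul0r ?mulr0 ltxx.
have e1 (u v : R) : 0 < u -> (u ^+ 3 < u ^+ 2 * v) = (u < v).
  by move=> u0; rewrite exprSr ltr_pM2l// exprn_gt0.
split=> [/and4P[h1 h2 h3 h4]|[h1 h2 h3 h4]].
  have [xp yp] := pos _ _ h1 x0 y0; split=> //; first by rewrite -(e1 _ _ xp).
  by rewrite -(e1 _ _ yp) mulrCA (mulrC (cabs y ^+ 2)).
have [xp yp] := pos _ _ h1 x0 y0; apply/and4P; split=> //; first by rewrite e1.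
by rewrite mulrA (mulrC _ (cabs y ^+ 2)) e1.
Qed.

(** The modulus of the monomial x^2 y, which the dominant part (x, y) -> (xy, x^2) of H sends
    exactly to its square. *)
Definition phi (p : R[i] * R[i] * R[i]) : R := cabs p.1.1 ^+ 2 * cabs p.1.2.

Hypotheses (eps1 : 8 * eps ^+ 2 <= 1) (epsb : 2 * cabs b * eps ^+ 2 <= 1).
Hypotheses (ra : 8 * cabs a <= r) (reps : 24 ^+ 3 <= r * eps ^+ 6).

Lemma Vminus_Hmap p : V p ->
  [/\ V (H p), phi p ^+ 2 <= 8 * phi (H p) & phi (H p) <= 4 * phi p ^+ 2].
Proof.
move: p => [[x y] z]; rewrite /Hmap !VminusE /phi /= => -[h1 h2 h3 h4].
apply: (@escape_estimates _ _ _ (cabs a) (cabs b) _ _ (cabs z)) => //.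
all: rewrite ?cabs_ge0 -?cabsM -?cabsX //.
- exact: cabsD.
- exact: cabsD_ge.
- exact: cabsD.
- exact: cabsD_ge.
Qed.
End Escape.

(** * Lift of the dynamics to homogeneous coordinates, and openness of V^- there *)

Section Homogenization.
Variable R : realType.
Local Notation hom4 := (R[i] * R[i] * R[i] * R[i])%type.

Lemma nbhs_cabs (z : R[i]) (e : R) : 0 < e -> nbhs z [set w | cabs (z - w) < e].
Proof.
move=> e0; have e0' : 0 < e%:C%C :> R[i] by rewrite ltcR.
apply/nbhs_ballP; exists e%:C%C => // w.
by rewrite -ball_normE /= normr_cabs ltcR.
Qed.

Lemma cabs_continuous : continuous (@cabs R).
Proof.
move=> z; apply/(@cvgrPdist_lt _ _ _ (nbhs z)) => e e0.
have Fz : Filter (nbhs z) by exact: nbhs_filter.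
apply: filterS (nbhs_cabs z e0) => w.
apply: le_lt_trans; rewrite ler_norml.
have := cabsD (z - w) w; have := cabsD (w - z) z.
by rewrite !subrK -[cabs (w - z)]cabsN opprB; lra.
Qed.

Section TopDomain.
Variable T : topologicalType.
Implicit Types f g : T -> R[i].

Lemma continuousM_C f g : continuous f -> continuous g -> continuous (fun p => f p * g p).
Proof. by move=> cf cg p; apply: cvgM; [exact: cf|exact: cg]. Qed.

Lemma continuousD_C f g : continuous f -> continuous g -> continuous (fun p => f p + g p).
Proof. by move=> cf cg p; apply: cvgD; [exact: cf|exact: cg]. Qed.

Lemma continuous_cabs f : continuous f -> continuous (fun p => cabs (f p)).
Proof. by move=> cf p; apply: continuous_comp; [exact: cf|exact: cabs_continuous]. Qed.

Lemma open_ltr (f g : T -> R) : continuous f -> continuous g -> open [set p | f p < g p].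
Proof.
move=> cf cg; have -> : [set p | f p < g p] = (g - f) @^-1` [set u | 0 < u].
  by apply/seteqP; split => p /=; rewrite subr_gt0.
apply: open_comp; last exact: open_gt.
by move=> p _; apply: cvgB; [exact: cg|exact: cf].
Qed.

End TopDomain.

Variables (a b : R[i]) (eps r : R).

(* The lift of [Hmap] to homogeneous coordinates [(x, y, z, t)]. *)
Definition homH (q : hom4) : hom4 :=
  let: (x, y, z, t) := q in (x * y + a * z * t, x ^+ 2 + b * y * t, x * t, t ^+ 2).

(* The homogenization of [Vminus]; at infinity it is the locus [xy != 0]. *)
Definition homV (q : hom4) : Prop :=
  let: (x, y, z, t) := q in
  [/\ r * cabs t ^+ 2 < cabs x * cabs y,
      2 * cabs a * cabs z * cabs t < cabs x * cabs y,
      cabs x * cabs t < cabs y ^+ 2 &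
      cabs y * cabs t < eps ^+ 2 * cabs x ^+ 2].

(** Meaningful only for t != 0; division by 0 returns 0. *)
Definition dehom (q : hom4) : R[i] * R[i] * R[i] :=
  let: (x, y, z, t) := q in (x / t, y / t, z / t).

(** The source [T] is arbitrary so as to cover both the parameter plane of a complex line and the
    space of nonzero vectors above P^3. *)
Definition continuous4 (T : topologicalType) (q : T -> hom4) :=
  [/\ continuous (fun p => (q p).1.1.1), continuous (fun p => (q p).1.1.2),
      continuous (fun p => (q p).1.2) & continuous (fun p => (q p).2)].

Lemma continuous_homH (T : topologicalType) (q : T -> hom4) :
  continuous4 q -> continuous4 (homH \o q).
Proof.
have -> : homH \o q = fun p =>
    ((q p).1.1.1 * (q p).1.1.2 + a * (q p).1.2 * (q p).2,
     (q p).1.1.1 ^+ 2 + b * (q p).1.1.2 * (q p).2,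
     (q p).1.1.1 * (q p).2, (q p).2 ^+ 2).
  by apply/funext => p; rewrite /comp; case: (q p) => [[[x y] z] t].
move=> [cx cy cz ct].
have cC (w : R[i]) : continuous (fun _ : T => w) by move=> ?; exact: cst_continuous.
split.
- apply: (continuousD_C (f := fun p => (q p).1.1.1 * (q p).1.1.2)).
    exact: continuousM_C.
  exact: (continuousM_C (continuousM_C (cC a) cz) ct).
- apply: (continuousD_C (f := fun p => (q p).1.1.1 ^+ 2)).
    exact: (continuousM_C cx cx).
  exact: (continuousM_C (continuousM_C (cC b) cy) ct).
- exact: continuousM_C.
- exact: (continuousM_C ct ct).
Qed.

Lemma continuous_iter_homH (T : topologicalType) (q : T -> hom4) n :
  continuous4 q -> continuous4 (iter n homH \o q).
Proof. by move=> cq; elim: n => [//|n IH]; apply: continuous_homH IH. Qed.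

Lemma open_homV (T : topologicalType) (q : T -> hom4) :
  continuous4 q -> open [set p | homV (q p)].
Proof.
move=> [cx cy cz ct].
have -> : [set p | homV (q p)] =
  [set p | r * cabs (q p).2 ^+ 2 < cabs (q p).1.1.1 * cabs (q p).1.1.2] `&`
  [set p | 2 * cabs a * cabs (q p).1.2 * cabs (q p).2 < cabs (q p).1.1.1 * cabs (q p).1.1.2] `&`
  ([set p | cabs (q p).1.1.1 * cabs (q p).2 < cabs (q p).1.1.2 ^+ 2] `&`
  [set p | cabs (q p).1.1.2 * cabs (q p).2 < eps ^+ 2 * cabs (q p).1.1.1 ^+ 2]).
  apply/seteqP; split => p /=; case: (q p) => [[[x y] z] t] /=.
    by case.
  by case=> -[? ?] [].
have cM (f g : T -> R) : continuous f -> continuous g -> continuous (fun p => f p * g p).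
  by move=> cf cg p; apply: cvgM; [exact: cf|exact: cg].
have cC (u : R) : continuous (fun _ : T => u) by move=> ?; exact: cst_continuous.
have [nx ny] := (continuous_cabs cx, continuous_cabs cy).
have [nz nt] := (continuous_cabs cz, continuous_cabs ct).
do !apply: openI; apply: open_ltr.
- exact: (cM _ _ (cC _) (cM _ _ nt nt)).
- exact: (cM _ _ nx ny).
- exact: (cM _ _ (cM _ _ (cM _ _ (cC _) (cC _)) nz) nt).
- exact: (cM _ _ nx ny).
- exact: (cM _ _ nx nt).
- exact: (cM _ _ ny ny).
- exact: (cM _ _ ny nt).
- exact: (cM _ _ (cC _) (cM _ _ nx nx)).
Qed.

Hypothesis eps0 : 0 < eps.
Hypothesis r0 : 0 <= r.

(** Both sides of each inequality of [homV] are those of [VminusE] at [dehom q], multiplied by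
    |t|^2. *)
Lemma homV_dehom q : q.2 != 0 -> homV q = Vminus a eps r (dehom q) :> Prop.
Proof.
move: q => [[[x y] z] t] t0.
rewrite -[dehom _]/(x / t, y / t, z / t) (VminusE _ eps0 r0) /= in t0 *.
rewrite !cabsM cabsV.
have T0 : 0 < cabs t by rewrite cabs_gt0.
have L u v u' v' : u' = u * cabs t ^+ 2 -> v' = v * cabs t ^+ 2 -> (u' < v') = (u < v).
  by move=> -> ->; rewrite ltr_pM2r// exprn_gt0.
have N : cabs t != 0 by rewrite gt_eqF.
by congr [/\ _, _, _ & _]; congr is_true; apply: L => //; field.
Qed.

Lemma dehom_homH q : q.2 != 0 -> dehom (homH q) = Hmap a b (dehom q).
Proof. by move: q => [[[x y] z] t] /= t0; congr (_, _, _); field. Qed.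

Lemma iter_homH_dehom n q : q.2 != 0 ->
  (iter n homH q).2 != 0 /\ dehom (iter n homH q) = iter n (Hmap a b) (dehom q).
Proof.
move=> q0; elim: n => [//|n [IH1 IH2]]; rewrite !iterS -IH2 -dehom_homH//.
by split=> //; move: (iter n homH q) IH1 => [[[x y] z] t] /= t0; rewrite expf_neq0.
Qed.

Lemma homV_iter n q : q.2 != 0 ->
  homV (iter n homH q) = Vminus a eps r (iter n (Hmap a b) (dehom q)) :> Prop.
Proof. by move=> /(iter_homH_dehom n) [? <-]; exact: homV_dehom. Qed.

End Homogenization.

(** * Points of K^+ on polynomial curves *)

Section EscapeCurves.
Variables (R : realType) (a b : R[i]) (eps r : R).
Hypotheses (eps0 : 0 < eps) (r0 : 0 <= r).
Hypotheses (eps1 : 8 * eps ^+ 2 <= 1) (epsb : 2 * cabs b * eps ^+ 2 <= 1).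
Hypotheses (ra : 8 * cabs a <= r) (reps : 24 ^+ 3 <= r * eps ^+ 6).
Local Notation H := (Hmap a b).
Local Notation V := (Vminus a eps r).
Local Notation curve X Y Z := (fun s => (X.[s], Y.[s], Z.[s])).

Lemma phi_ge0 (p : R[i] * R[i] * R[i]) : 0 <= phi p.
Proof. by rewrite /phi mulr_ge0 ?sqr_ge0 ?cabs_ge0. Qed.

(** Used contrapositively: a zero of [phi] after n steps is a point whose n-th iterate is outside
    V^-. *)
Lemma phi_Vminus p : V p -> phi p != 0.
Proof.
move: p => [[x y] z]; rewrite VminusE//= => -[rxy _ _ _].
have : cabs x * cabs y != 0 by rewrite gt_eqF// (le_lt_trans r0).
by rewrite mulf_eq0 negb_or /phi /= => /andP[? ?]; rewrite mulf_neq0// expf_neq0.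
Qed.

Lemma Vminus_iter j n p : (j <= n)%N -> V (iter j H p) -> V (iter n H p).
Proof.
move=> /subnK <-; elim: (n - j)%N => [//|k IH] /IH.
by rewrite addSn => /(Vminus_Hmap eps0 r0 eps1 epsb ra reps)[].
Qed.

(* [phi (H p)] is [phi p ^+ 2] up to a factor in [[1/8, 4]], so a ratio of at
   least 32 between two values of [phi] does not decrease along orbits. *)
Lemma phi_iter_ratio n p q : V p -> V q -> 32 * phi q <= phi p ->
  32 * phi (iter n H q) <= phi (iter n H p).
Proof.
move=> Vp Vq pq; elim: n => [//|n IH].
have [_ lp _] := Vminus_Hmap eps0 r0 eps1 epsb ra reps (@Vminus_iter 0 n p (leq0n n) Vp).
have [_ _ uq] := Vminus_Hmap eps0 r0 eps1 epsb ra reps (@Vminus_iter 0 n q (leq0n n) Vq).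
rewrite !iterS; have := phi_ge0 (iter n H q); nra.
Qed.

(** This makes [phi] after n steps the modulus of a polynomial in the parameter, to which the
    minimum modulus principle applies. *)
Lemma iter_Hmap_curve n (X Y Z : {poly R[i]}) : exists X' Y' Z' : {poly R[i]},
  forall s, iter n H (curve X Y Z s) = curve X' Y' Z' s.
Proof.
elim: n => [|n [X' [Y' [Z' IH]]]]; first by exists X, Y, Z.
exists (X' * Y' + a *: Z'), (X' ^+ 2 + b *: Y'), X' => s.
by rewrite iterS IH /= !hornerE.
Qed.

Lemma curve_leaves_Vminus n (X Y Z : {poly R[i]}) (rho : R) : 0 < rho ->
  V (curve X Y Z 0) ->
  (forall s, cabs s = rho ->
    V (curve X Y Z s) /\ 32 * phi (curve X Y Z 0) <= phi (curve X Y Z s)) ->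
  exists2 s, cabs s <= rho & ~ V (iter n H (curve X Y Z s)).
Proof.
move=> rho0 V0 Vrho; have [X' [Y' [Z' E]]] := iter_Hmap_curve n X Y Z.
have phiE s : phi (iter n H (curve X Y Z s)) = cabs (X' ^+ 2 * Y').[s].
  by rewrite E /phi /= !hornerE cabsM cabsX.
have [|s /eqP root_s srho] := @root_of_min_modulus _ (X' ^+ 2 * Y') rho rho0.
  move=> s /Vrho[Vs ratio]; rewrite -!phiE.
  have := phi_iter_ratio n Vs V0 ratio; have := phi_ge0 (iter n H (curve X Y Z 0)); lra.
exists s => // /phi_Vminus; rewrite phiE root_s cabs0 eqxx; exact.
Qed.

(** Transfers to [R[i]] the compactness argument carried out in [R * R]. *)
Lemma complex_continuous : continuous (fun q : R * R => (q.1 +i* q.2)%C).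
Proof.
have rc : continuous (fun u : R => u%:C%C).
  move=> u; apply/(@cvgrPdist_lt _ _ _ (nbhs u)) => -[e e'] /=.
  rewrite ltcE /= => /andP[/eqP-> e0].
  have : \forall t \near u, `|u - t| < e
    by exact: (@cvgr_dist_lt _ _ _ (nbhs u) _ id u (@cvg_id _ _) e e0).
  apply: filterS => t ute; rewrite normr_cabs ltcR.
  by rewrite -rmorphB /= /cabs /= expr0n addr0 sqrtr_sqr.
have -> : (fun q : R * R => (q.1 +i* q.2)%C) = (fun q => q.1%:C%C + 'i%C * q.2%:C%C).
  by apply/funext => q; rewrite [LHS]complexE.
apply: continuousD_C; last apply: continuousM_C; last 2 first.
- exact: cst_continuous.
- by move=> q; apply: continuous_comp; [exact: cvg_snd|exact: rc].
- by move=> q; apply: continuous_comp; [exact: cvg_fst|exact: rc].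
Qed.

Lemma horner_continuous_C (T : topologicalType) (f : T -> R[i]) (p : {poly R[i]}) :
  continuous f -> continuous (fun q => p.[f q]).
Proof.
move=> cf; elim/poly_ind: p => [|p c IH].
  by under eq_fun do rewrite horner0; exact: cst_continuous.
under eq_fun do rewrite hornerMXaddC.
by apply: continuousD_C; [exact: continuousM_C|exact: cst_continuous].
Qed.

Lemma Kplus_curve (X Y Z : {poly R[i]}) (rho : R) : 0 < rho ->
  V (curve X Y Z 0) ->
  (forall s, cabs s = rho ->
    V (curve X Y Z s) /\ 32 * phi (curve X Y Z 0) <= phi (curve X Y Z s)) ->
  exists2 s, cabs s <= 2 * rho & Kplus a b eps r (curve X Y Z s).
Proof.
move=> rho0 V0 Vrho.
have /choice[s sP] n : exists s, cabs s <= rho /\ ~ V (iter n H (curve X Y Z s)).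
  by have [s] := @curve_leaves_Vminus n X Y Z rho rho0 V0 Vrho; exists s.
pose S n : R * R := (complex.Re (s n), complex.Im (s n)).
have SE n : ((S n).1 +i* (S n).2)%C = s n by rewrite /S; case: (s n).
(* A compact square around the disk of radius rho; its points have modulus at most 2 rho, whence the
   2 in the conclusion. *)
pose K := `[- rho, rho]%classic `*` `[- rho, rho]%classic : set (R * R).
have KS n : K (S n).
  by split; rewrite /= in_itv /= -ler_norml (le_trans _ (sP n).1)// ?le_normr_Re ?le_normr_Im.
have cK : compact K by apply: compact_setX; exact: segment_compact.
have [|p [[p1 p2] clp]] := cK (S @ \oo) _; first by exists 0 => // n _; exact: KS.
exists (p.1 +i* p.2)%C.
  have : cabs (p.1 +i* p.2)%C <= `|p.1| + `|p.2|.
    have -> : (p.1 +i* p.2)%C = p.1%:C%C + 'i%C * p.2%:C%C by rewrite [LHS]complexE.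
    apply: le_trans (cabsD _ _) _; rewrite cabsM; apply: lerD.
      by rewrite /cabs /= expr0n addr0 sqrtr_sqr.
    by rewrite /cabs /= !expr0n !addr0 add0r expr1n sqrtr1 mul1r sqrtr_sqr.
  move: p1 p2; rewrite /= !in_itv /= -!ler_norml; lra.
(* If the cluster point entered V^- at time j, then by openness so would some [S n] with j <= n; by
   invariance its n-th iterate would lie in V^-, against the choice of [s n]. *)
move=> [j _ /= Vj].
pose q (u : R * R) : R[i] * R[i] * R[i] * R[i] :=
  (X.[(u.1 +i* u.2)%C], Y.[(u.1 +i* u.2)%C], Z.[(u.1 +i* u.2)%C], 1).
have cq : continuous4 q.
  by split; rewrite /q /=; try exact: cst_continuous;
    apply: horner_continuous_C; exact: complex_continuous.
have VE u : homV a eps r (iter j (homH a b) (q u)) =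
    V (iter j H (curve X Y Z (u.1 +i* u.2)%C)) :> Prop.
  by rewrite homV_iter ?oner_neq0//= !divr1.
have oV : nbhs p [set u | homV a eps r (iter j (homH a b) (q u))].
  apply: open_nbhs_nbhs; split; last by rewrite /= VE.
  exact: (open_homV _ _ _ (continuous_iter_homH a b j cq)).
have [u [[n jn <-] /=]] : [set S n | n in [set n | (j <= n)%N]] `&`
    [set u | homV a eps r (iter j (homH a b) (q u))] !=set0.
  by apply: clp => //; exists j => // n /= jn; exists n.
by rewrite VE SE => /(Vminus_iter jn); exact: (sP n).2.
Qed.

End EscapeCurves.

(** * Density of K^+ near the points of I^+ at infinity *)

Section NearInfinity.
Variables (R : realType) (a b : R[i]) (eps r : R).
Hypotheses (eps0 : 0 < eps) (r0 : 0 <= r).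

(** The left sides of [homV] tend to 0 with t, uniformly for coordinates bounded by M, while the
    right sides are at least m^2, up to eps^2 in the last one. *)
Lemma homV_near_infinity (m M : R) : 0 < m -> 0 <= M -> exists2 d : R, 0 < d &
  forall x y z t : R[i], cabs t < d -> m <= cabs x <= M -> m <= cabs y <= M ->
    cabs z <= M -> homV a eps r (x, y, z, t).
Proof.
move=> m0 M0; have A0 := cabs_ge0 a.
have AM : 0 <= cabs a * M by exact: mulr_ge0.
have eM : 0 <= eps ^- 2 * M by rewrite mulr_ge0// invr_ge0 sqr_ge0.
(* D bounds the coefficient of |t| in all four inequalities, the last one divided by eps^2; |t| < 1
   will reduce |t|^2 to |t| in the first. *)
have [D [D0 rD AD MD ED]] : exists D, [/\ 0 < D, r <= D, 2 * (cabs a * M) <= D,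
    M <= D & eps ^- 2 * M <= D].
  exists (r + 2 * (cabs a * M) + M + eps ^- 2 * M + 1).
  move: r0 (cabs a * M) AM M0 (eps ^- 2 * M) eM => r0' AM + M0' E.
  by move=> *; split; lra.
exists (Num.min 1 (m ^+ 2 / D)); first by rewrite lt_min ltr01 divr_gt0// exprn_gt0.
move=> x y z t; rewrite lt_min ltr_pdivlMr// => /andP[t1 tD] /andP[mx xM] /andP[my yM] zM.
have T0 := cabs_ge0 t.
have small u : u <= D -> u * cabs t < m ^+ 2.
  by move=> uD; rewrite (le_lt_trans _ tD)// mulrC ler_wpM2l.
have mxy : m ^+ 2 <= cabs x * cabs y by rewrite expr2 ler_pM// ltW.
have my2 : m ^+ 2 <= cabs y ^+ 2 by rewrite lerXn2r ?nnegrE ?cabs_ge0// ltW.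
have mx2 : m ^+ 2 <= cabs x ^+ 2 by rewrite lerXn2r ?nnegrE ?cabs_ge0// ltW.
split.
- apply: lt_le_trans mxy; apply: le_lt_trans (small r rD).
  by rewrite ler_wpM2l// expr2 ler_piMl// ltW.
- apply: lt_le_trans mxy; apply: le_lt_trans (small (2 * (cabs a * M)) AD).
  by rewrite ler_wpM2r// -mulrA ler_wpM2l// ler_wpM2l.
- apply: lt_le_trans my2; apply: le_lt_trans (small M MD).
  by rewrite ler_wpM2r.
- have e2 : 0 < eps ^+ 2 by exact: exprn_gt0.
  rewrite -ltr_pdivrMl//; apply: lt_le_trans mx2.
  apply: le_lt_trans (small (eps ^- 2 * M) ED).
  by rewrite mulrA ler_wpM2r// ler_wpM2l// invr_ge0 ltW.
Qed.

Hypotheses (eps1 : 8 * eps ^+ 2 <= 1) (epsb : 2 * cabs b * eps ^+ 2 <= 1).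
Hypotheses (ra : 8 * cabs a <= r) (reps : 24 ^+ 3 <= r * eps ^+ 6).

(** With z and a small t fixed, the center and boundary of the disk lie in V^- by
    [homV_near_infinity]. Passing to affine coordinates divides x^2 y by t^3 throughout, which
    leaves the ratio 32 unchanged. *)
Lemma Kplus_near_infinity (x y z u v : R[i]) (rho m e : R) :
  0 < rho -> 0 < m -> 0 < e -> m <= cabs x -> m <= cabs y ->
  (forall s, cabs s = rho ->
    [/\ m <= cabs (x + u * s), m <= cabs (y + v * s) &
        32 * (cabs x ^+ 2 * cabs y) <=
          cabs (x + u * s) ^+ 2 * cabs (y + v * s)]) ->
  exists s t : R[i], [/\ cabs s <= 2 * rho, t != 0, cabs t < e &
    Kplus a b eps r (dehom (x + u * s, y + v * s, z, t))].
Proof.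
move=> rho0 m0 e0 mx my circ.
(* Bounds the moduli of all three numerators at the center and on the circle. *)
pose M := cabs x + cabs y + cabs z + cabs u * rho + cabs v * rho.
have [[hx hy] hz] := (cabs_ge0 x, cabs_ge0 y, cabs_ge0 z).
have hu : 0 <= cabs u * rho by rewrite mulr_ge0 ?cabs_ge0 ?ltW.
have hv : 0 <= cabs v * rho by rewrite mulr_ge0 ?cabs_ge0 ?ltW.
have M0 : 0 <= M by rewrite /M; lra.
have [d d0 dV] := homV_near_infinity m0 M0.
pose tau := Num.min d e / 2.
have tau0 : 0 < tau by rewrite /tau divr_gt0// lt_min d0.
have /andP[taud taue] : (tau < d) && (tau < e).
  rewrite -lt_min /tau; have : 0 < Num.min d e by rewrite lt_min d0.
  by lra.
pose t : R[i] := tau%:C%C.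
have tE : cabs t = tau by rewrite cabs_real ?ltW.
have t0 : t != 0 by rewrite -cabs_gt0 tE.
pose X := t^-1 *: (x%:P + u *: 'X); pose Y := t^-1 *: (y%:P + v *: 'X).
have curveE s : (X.[s], Y.[s], (t^-1 * z)%:P.[s]) = dehom (x + u * s, y + v * s, z, t).
  by rewrite /X /Y !hornerE /= ![_ / t]mulrC.
have phiE s : phi (dehom (x + u * s, y + v * s, z, t)) =
    cabs (x + u * s) ^+ 2 * cabs (y + v * s) / tau ^+ 3.
  by rewrite /phi /= !cabsM cabsV tE; field; rewrite gt_eqF.
have inV s : cabs (x + u * s) \in `[m, M] -> cabs (y + v * s) \in `[m, M] ->
    Vminus a eps r (dehom (x + u * s, y + v * s, z, t)).
  move=> xs ys; rewrite !in_itv /= in xs ys.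
  rewrite -(@homV_dehom _ a eps r)//.
  by apply: dV => //; rewrite ?tE// /M; lra.
have V0 : Vminus a eps r (dehom (x + u * 0, y + v * 0, z, t)).
  by apply: inV; rewrite !mulr0 !addr0 in_itv /= ?mx ?my /= /M; lra.
have [||s s2 Ks] := Kplus_curve eps0 r0 eps1 epsb ra reps (X := X) (Y := Y)
    (Z := (t^-1 * z)%:P) rho0.
- by rewrite curveE.
- move=> s srho; rewrite !curveE !phiE; have [cx cy cp] := circ s srho; split.
    have := cabsD x (u * s); have := cabsD y (v * s); rewrite !cabsM srho => ? ?.
    by apply: inV; rewrite in_itv /= ?cx ?cy /= /M; lra.
  by rewrite !mulr0 !addr0 mulrA ler_pM2r ?invr_gt0 ?exprn_gt0.
by exists s, t; rewrite tE -curveE.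
Qed.

Lemma Kplus_dense_at_infinity (x y z : R[i]) (e : R) : x = 0 \/ y = 0 -> 0 < e ->
  exists x' y' t : R[i], [/\ cabs (x' - x) < e, cabs (y' - y) < e, t != 0, cabs t < e &
    Kplus a b eps r (dehom (x', y', z, t))].
Proof.
move=> xy e0.
(* The coordinate held constant along the line must be nonzero, so it is perturbed where both x and
   y vanish. *)
have pert w : exists2 w' : R[i], w' != 0 & cabs (w' - w) < e.
  have [->|w0] := eqVneq w 0; last by exists w; rewrite ?subrr ?cabs0.
  exists (e / 2)%:C%C; rewrite -?cabs_gt0 ?subr0 cabs_real; lra.
(* With center of modulus d and radius 40 d, the moving coordinate has modulus at least 39 d on the
   circle: 39 >= 32 suffices when y moves, and 39^2 when x moves. The point found has |s| <= 80 d,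
   so |c + s| <= 81 d < e. *)
pose d := e / 100; have d0 : 0 < d by rewrite /d; lra.
pose c : R[i] := d%:C%C; have cE : cabs c = d by rewrite cabs_real ?ltW.
have rho0 : 0 < 40 * d by lra.
have far s : cabs s = 40 * d -> 39 * d <= cabs (c + s).
  by move=> sE; rewrite addrC; have := cabsD_ge s c; rewrite cE sE; lra.
have near s : cabs s <= 2 * (40 * d) -> cabs (c + s) < e.
  by move=> sE; have := cabsD c s; rewrite cE /d in sE *; lra.
case: xy => [->|->].
- have [y' y'0 y'y] := pert y; rewrite -cabs_gt0 in y'0.
  have [|||s|s [t [s2 t0 te Kst]]] := @Kplus_near_infinity c y' z 1 0 (40 * d)
      (Num.min d (cabs y')) e rho0 _ e0.
  + by rewrite lt_min d0.
  + by rewrite ge_min cE lexx.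
  + by rewrite ge_min lexx orbT.
  + move=> /far cs; rewrite mul1r mul0r addr0 !ge_min lexx orbT cE.
    split=> //; first by apply/orP; left; lra.
    rewrite mulrA ler_pM2r//; nra.
  exists (c + s), y', t; rewrite subr0 near//; split=> //.
  by rewrite mul1r mul0r addr0 in Kst.
- have [x' x'0 x'x] := pert x; rewrite -cabs_gt0 in x'0.
  have [|||s|s [t [s2 t0 te Kst]]] := @Kplus_near_infinity x' c z 0 1 (40 * d)
      (Num.min d (cabs x')) e rho0 _ e0.
  + by rewrite lt_min d0.
  + by rewrite ge_min lexx orbT.
  + by rewrite ge_min cE lexx.
  + move=> /far cs; rewrite mul1r mul0r addr0 !ge_min lexx orbT cE.
    split=> //; first by apply/orP; left; lra.
    by rewrite mulrCA ler_pM2l ?exprn_gt0//; lra.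
  exists x', (c + s), t; rewrite subr0 near//; split=> //.
  by rewrite mul1r mul0r addr0 in Kst.
Qed.

End NearInfinity.

(** * Passage to the quotient P^3 and computation of the closure *)

Section ProjectiveClosure.
Variable R : realType.
Local Notation hom4 := (R[i] * R[i] * R[i] * R[i])%type.

Definition iz : 'I_4 := @Ordinal 4 2 isT.

Definition coords (v : hvec R) : hom4 :=
  (coordinate v ix, coordinate v iy, coordinate v iz, coordinate v it).

Lemma hclassP (u v : hvec R) :
  hclass u = hclass v <-> exists2 c : R[i], c != 0 & val v = c *: val u.
Proof. by split=> [/eqmodP/asboolP|/asboolP uv] //; apply/eqmodP. Qed.

Lemma continuous4_coords : continuous4 coords.
Proof.
have cc (i : 'I_4) : continuous (fun v : hvec R => coordinate v i).
  have cv : continuous (fun v : hvec R => val v : 'rV[R[i]]_4) by exact: initial_continuous.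
  move=> v; exact: (continuous_comp (cv v) (@coord_continuous _ _ _ 0 i (val v))).
by split; exact: cc.
Qed.

Lemma hclass_surj (p : P3 R) : exists v, p = hclass v.
Proof. by exists (repr p); rewrite /hclass reprK. Qed.

Lemma hclass_affine (v : hvec R) : coordinate v it != 0 ->
  hclass v = affine (dehom (coords v)).
Proof.
move=> t0; apply/hclassP; exists (coordinate v it)^-1; first by rewrite invr_eq0.
apply/rowP => i; rewrite !mxE /=.
case: i => -[|[|[|[|//]]]] lti /=; rewrite mulrC; last first.
  by rewrite -[X in X / _](_ : coordinate v it = _) ?divff//; congr (sval v 0 _); exact: val_inj.
all: by congr (_ * sval v 0 _); exact: val_inj.
Qed.

Lemma coords_affine (p : C3 R) (v : hvec R) : hclass v = affine p ->
  coordinate v it != 0 /\ dehom (coords v) = p.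
Proof.
move: p => [[x y] z] /esym vE; have [c c0 {}vE] := (hclassP _ _).1 vE.
have cE i : coordinate v i = c * (affine_row (x, y, z)) 0 i by rewrite /coordinate vE mxE.
rewrite /coords !cE !mxE /= !mulr1; split=> //.
by congr (_, _, _); rewrite mulrC mulKf.
Qed.

Lemma Iplus_inftyP (v : hvec R) : Iplus_infty (hclass v) <->
  coordinate v it = 0 /\ (coordinate v ix = 0 \/ coordinate v iy = 0).
Proof.
have cE (u w : hvec R) i : hclass u = hclass w -> coordinate u i = 0 -> coordinate w i = 0.
  by move=> uw; have [c c0 wE] := (hclassP _ _).1 uw;
    rewrite /coordinate wE mxE => ->; rewrite mulr0.
split=> [[[u [ut ux] uv]|[u [ut uy] uv]]|[vt [vx|vy]]].
- by split; [|left]; exact: cE uv _.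
- by split; [|right]; exact: cE uv _.
- by left; exists v.
- by right; exists v.
Qed.

(** An open set of the quotient pulls back to the trace on the nonzero vectors of an open set of row
    vectors, which contains a ball for the sup norm. *)
Lemma hclass_near (U : set (P3 R)) (v : hvec R) : nbhs (hclass v) U ->
  exists2 e : R, 0 < e & forall w : hvec R,
    (forall i, cabs (coordinate w i - coordinate v i) < e) -> U (hclass w).
Proof.
rewrite nbhsE => -[W [oW Wv] WU].
have [O oO OW] : open (@hclass R @^-1` W) by exact: oW.
have /nbhs_ballP[[e e'] /= + +] : nbhs (val v : 'rV[R[i]]_4) O.
  by apply: open_nbhs_nbhs; split=> //; have : (@hclass R @^-1` W) v by []; rewrite -OW.
rewrite ltcE /= => /andP[/eqP-> e0] eO; exists e => // w wv; apply: WU.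
suff : (@hclass R @^-1` W) w by [].
rewrite -OW; apply: eO; split=> [|i j]; first by rewrite ltcE /= eqxx.
rewrite -ball_normE /= (ord1 i) normr_cabs ltcR.
by rewrite -cabsN opprB; exact: wv.
Qed.

Variables (a b : R[i]) (eps r : R).
Hypotheses (eps0 : 0 < eps) (r0 : 0 <= r).

(** The complement pulls back to an open set of nonzero vectors: [O n] accounts for the affine
    points in V^- at time n, and [homV] for the points at infinity with xy != 0. *)
Lemma closed_Kplus_Iplus_infty :
  closed (@affine R @` Kplus a b eps r `|` @Iplus_infty R).
Proof.
rewrite -openC.
pose O n := [set v | coordinate v it != 0 :> R[i]] `&`
  [set v | homV a eps r (iter n (homH a b) (coords v))].
have oO : open ([set v | homV a eps r (coords v)] `|` \bigcup_n O n).
  apply: openU; first exact: open_homV continuous4_coords.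
  apply: bigcup_open => n _; apply: openI.
    have -> : [set v | coordinate v it != 0] =
        [set v : hvec R | 0 < cabs (coordinate v it)].
      by apply/seteqP; split => v /=; rewrite cabs_gt0.
    apply: open_ltr; first by move=> ?; exact: cst_continuous.
    by have [_ _ _ ct] := continuous4_coords; exact: continuous_cabs ct.
  exact: (open_homV _ _ _ (continuous_iter_homH a b n continuous4_coords)).
(* Openness in the quotient topology is openness of the preimage under [hclass]. *)
suff E : @hclass R @^-1` (~` (@affine R @` Kplus a b eps r `|` @Iplus_infty R)) =
    [set v | homV a eps r (coords v)] `|` \bigcup_n O n.
  by rewrite -E in oO; exact: oO.
have finite n v : O n v -> ~ (@affine R @` Kplus a b eps r `|` @Iplus_infty R) (hclass v).
  move=> [/= t0 Vv] [[p Kp /esym pv]|/Iplus_inftyP[]]; last by move: t0 => /eqP.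
  have [_ vp] := coords_affine pv.
  by apply: Kp; exists n => //=; rewrite -vp -homV_iter.
apply/seteqP; split => v /=.
  move=> nAI; have [t0|t0] := eqVneq (coordinate v it) 0.
    (* At t = 0 every left side vanishes, so only x != 0 and y != 0 remain to be shown. *)
    left; rewrite /= /coords /homV t0 cabs0 expr0n !mulr0.
    have x0 : 0 < cabs (coordinate v ix).
      rewrite cabs_gt0; apply/eqP => x0; apply: nAI; right.
      by apply/Iplus_inftyP; split=> //; left.
    have y0 : 0 < cabs (coordinate v iy).
      rewrite cabs_gt0; apply/eqP => y0; apply: nAI; right.
      by apply/Iplus_inftyP; split=> //; right.
    by rewrite !mulr_gt0 ?exprn_gt0.
  right; apply: contrapT => nU; apply: nAI; left.
  exists (dehom (coords v)); last by rewrite -hclass_affine.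
  by move=> [n _ /= Vn]; apply: nU; exists n => //; split=> //=; rewrite homV_iter.
move=> [/= Vv|[n _ /finite//]].
have [t0|t0] := eqVneq (coordinate v it) 0; last exact: (finite 0%N).
move: Vv; rewrite /coords /homV t0 cabs0 expr0n !mulr0 => -[xy _ _ _].
move=> [[p _ /esym pv]|/Iplus_inftyP[_ [xy0|xy0]]].
- by have [] := coords_affine pv; rewrite t0 eqxx.
- by move: xy; rewrite xy0 cabs0 mul0r ltxx.
- by move: xy; rewrite xy0 cabs0 mulr0 ltxx.
Qed.

Hypotheses (eps1 : 8 * eps ^+ 2 <= 1) (epsb : 2 * cabs b * eps ^+ 2 <= 1).
Hypotheses (ra : 8 * cabs a <= r) (reps : 24 ^+ 3 <= r * eps ^+ 6).

Lemma closure_Kplus :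
  closure (@affine R @` Kplus a b eps r) =
  (@affine R @` Kplus a b eps r) `|` @Iplus_infty R.
Proof.
apply/seteqP; split.
  rewrite [X in _ `<=` X](closure_id _).1; last exact: closed_Kplus_Iplus_infty.
  by apply: closure_subset; exact: subsetUl.
move=> p [|]; first exact: subset_closure.
have [v ->] := hclass_surj p => /Iplus_inftyP[t0 xy] U /hclass_near[e e0 near].
have [x' [y' [t [hx hy tn0 te Kt]]]] := Kplus_dense_at_infinity eps0 r0 eps1 epsb
  ra reps (coordinate v iz) xy e0.
(* A representative close to [v] with the same z; as t != 0, its class is an affine point, and it
   lies in K^+. *)
pose w : 'rV[R[i]]_4 := \row_(i < 4) [:: x'; y'; coordinate v iz; t]`_i.
have w0 : w \in [set w : 'rV[R[i]]_4 | w != 0].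
  by rewrite inE; apply/eqP => /rowP /(_ it); rewrite !mxE /=; apply/eqP.
pose h : hvec R := exist _ w w0.
have ht : coordinate h it = t by rewrite /coordinate mxE.
exists (hclass h); split.
  exists (dehom (coords h)); last by rewrite -hclass_affine// ht.
  by rewrite /coords /coordinate !mxE.
apply: near => i; rewrite {1}/coordinate mxE.
case: i => -[|[|[|[|//]]]] lti /=.
- by rewrite (_ : Ordinal lti = ix) //; exact: val_inj.
- by rewrite (_ : Ordinal lti = iy) //; exact: val_inj.
- by rewrite (_ : Ordinal lti = iz) ?subrr ?cabs0//; exact: val_inj.
- by rewrite (_ : Ordinal lti = it) ?t0 ?subr0//; exact: val_inj.
Qed.

End ProjectiveClosure.

Theorem theorem3p4 (R : realType) (a b : R[i]) (ha : a != 0) (hb : b != 0) :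
  exists2 eps0 : R, 0 < eps0 &
    forall eps : R, 0 < eps -> eps < eps0 ->
      exists r0 : R, forall r : R, r0 < r ->
        closure (@affine R @` Kplus a b eps r) =
        (@affine R @` Kplus a b eps r) `|` @Iplus_infty R.
Proof.
have [A0 B0] := (cabs_ge0 a, cabs_ge0 b).
have D0 : 0 < 8 + 2 * cabs b by lra.
(* Since eps^2 <= eps, this bound yields both 8 eps^2 <= 1 and 2 |b| eps^2 <= 1. *)
exists (8 + 2 * cabs b)^-1; first by rewrite invr_gt0.
(* The two summands yield 8 |a| <= r and 24^3 <= r eps^6. *)
move=> eps eps0 epsD; exists (8 * cabs a + 24 ^+ 3 / eps ^+ 6) => r.
have eD : (8 + 2 * cabs b) * eps < 1 by rewrite mulrC -ltr_pdivlMr// mul1r.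
have e6 : 0 < eps ^+ 6 by exact: exprn_gt0.
have q0 : 0 <= 24 ^+ 3 / eps ^+ 6 by rewrite divr_ge0 ?exprn_ge0 ?ltW.
have be : 0 <= cabs b * eps by rewrite mulr_ge0// ltW.
have e1 : eps <= 1 by lra.
have e2 : eps ^+ 2 <= eps by rewrite expr2 ler_piMl// ltW.
have be2 : cabs b * eps ^+ 2 <= cabs b * eps by rewrite ler_wpM2l.
have : 24 ^+ 3 / eps ^+ 6 * eps ^+ 6 = 24 ^+ 3 by rewrite mulfVK// gt_eqF.
move: (24 ^+ 3 / eps ^+ 6) q0 => q q0 qE qr.
apply: closure_Kplus => //; try lra.
by rewrite -qE ler_pM2r//; lra.
Qed.
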